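(* Let $G$ be a graph. Then $T_G(0,2)$ is the number of orientations of $G$ for which every connected component of $G$, with the induced orientation, is strongly connected.
   Context: Graphs are finite and simple: $G=(V(G),E(G))$ with $E(G)$ a set of unordered pairs of distinct vertices; the empty graph is allowed. $\mathrm{cc}(G)$ is the number of connected components of $G$. For $F\subseteq E(G)$, $G_{\mid F}$ is the graph with vertex set $V(G)$ and edge set $F$. The Tutte polynomial is $T_G(X,Y)=\sum_{F\subseteq E(G)} (X-1)^{\mathrm{cc}(G_{\mid F})-\mathrm{cc}(G)} (Y-1)^{\mathrm{cc}(G_{\mid F})+|F|-|V(G)|}$, a polynomial over a field of characteristic $0$. An orientation of $G$ is obtained by choosing, for each edge $\{u,v\}$ of $G$, exactly one of the arcs $(u,v)$, $(v,u)$. An oriented graph is strongly connected if for any vertices $x,y$ there is an oriented path from $x$ to $y$. *)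

(* Defs.v *)
From HB Require Import structures.
From mathcomp Require Import all_boot all_order all_algebra.
From mathcomp Require Import mpoly.

Set Implicit Arguments.
Unset Strict Implicit.
Unset Printing Implicit Defensive.

Import GRing.Theory.

Local Open Scope ring_scope.

Record sgraph := SGraph {
  vertex : finType;
  edges : {set {set vertex}};
  edges_card2 : forall e, e \in edges -> #|e| = 2%N
}.

(* Irreflexive: [set x; x] has cardinality 1. *)
Definition adj (G : sgraph) : rel (vertex G) :=
  [rel x y | [set x; y] \in edges G].

Definition components (G : sgraph) : {set {set vertex G}} :=
  [set [set y | connect (@adj G) x y] | x in [set: vertex G]].

Definition cc (G : sgraph) : nat := #|components G|.

Lemma restrict_card2 (G : sgraph) (F : {set {set vertex G}}) e :
  e \in edges G :&: F -> #|e| = 2%N.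
Proof. by case/setIP=> /edges_card2. Qed.

(* G_{|F}; intersecting with [edges G] makes it total in F, and changes nothing
   when F is a set of edges of G. *)
Definition restrict (G : sgraph) (F : {set {set vertex G}}) : sgraph :=
  SGraph (@restrict_card2 G F).

(* The variables X and Y are 'X_0 and 'X_1. Both exponents are nonnegative for
   F \subset edges G, so truncated subtraction agrees with subtraction in Z
   (the second one is parenthesized as (cc + #|F|) - #|V|). *)
Definition tutte (K : fieldType) (G : sgraph) : {mpoly K[2]} :=
  \sum_(F : {set {set vertex G}} | F \subset edges G)
     ('X_(0 : 'I_2) - 1) ^+ (cc (restrict F) - cc G)
   * ('X_(1 : 'I_2) - 1) ^+ (cc (restrict F) + #|F| - #|vertex G|).

(* An orientation is encoded by its set of arcs. *)
Definition is_orientation (G : sgraph) (A : {set vertex G * vertex G}) : bool :=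
  [forall u, forall v,
     if [set u; v] \in edges G then ((u, v) \in A) (+) ((v, u) \in A)
     else (u, v) \notin A].

(* The arcs of A with both ends in C. *)
Definition induced_arc (V : finType) (A : {set V * V}) (C : {set V}) : rel V :=
  [rel u v | [&& u \in C, v \in C & (u, v) \in A]].

Definition strongly_connected_on (V : finType) (A : {set V * V})
    (C : {set V}) : bool :=
  [forall x in C, forall y in C, connect (induced_arc A C) x y].

(* Main.v *)
Require Import Defs.
From HB Require Import structures.
From mathcomp Require Import all_boot all_order all_algebra.
From mathcomp Require Import mpoly.

Set Implicit Arguments.
Unset Strict Implicit.
Unset Printing Implicit Defensive.

Import GRing.Theory.
Local Open Scope ring_scope.

(** The value of the Tutte polynomial at (0, 2) is the alternating sum of
    (-1)^(cc(G|F) - cc(G)) over the sets F of edges.  An orientation makes every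
    component strongly connected exactly when reachability along its arcs is a
    symmetric relation; call such a set of arcs balanced.

    The equality is an instance of a statement about two sets S and E of edges
    on one vertex set, where the edges of S have been contracted.  Contraction
    is modelled by keeping both arcs of each edge of S, so that the vertex set
    never changes: the number of orientations A of E such that the arcs of S
    together with A are balanced is the sum over F included in E of
    (-1)^(c(S u F) + c(S u E)), where c counts components
    ([balanced_orientations]).  The proof is by deletion and contraction of an
    edge uv, for E consisting of uv and a set E' of other edges.

    If u and v are not joined by S u E', then the edge is a bridge.  No
    orientation is balanced ([bridge_unbalanced]), and adding uv to a subset of
    E' lowers the number of components by one ([ncomp_join]), so the terms of
    the sum cancel in pairs.

    If u and v are joined by S u E', then, for the arcs D of S together with an
    orientation of E',
      [D + uv] + [D + vu] = [D] + [D + uv + vu],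
    where brackets are 1 on balanced sets and 0 otherwise
    ([balanced_exchange]).  Summed over the orientations of E', this is the
    deletion-contraction recurrence, which the alternating sum also satisfies.
    The exchange identity rests on the description of balanced sets by cuts
    ([balancedP]): a set of vertices that no arc leaves is entered by no arc. *)

(** * Balanced sets of arcs *)

Section Balanced.

Variable V : finType.
Implicit Types (D : {set V * V}) (U W : {set V}) (u v x y : V).

Lemma connect_stable (r : rel V) (P : pred V) x y :
  (forall a b, r a b -> P a -> P b) -> connect r x y -> P x -> P y.
Proof.
move=> rP /connectP[p xp ->]; elim: p x xp => [|a p IHp] x //=.
by case/andP=> rxa pa Px; apply: IHp => //; apply: rP rxa Px.
Qed.

(** One step along an arc of [D]. *)
Definition arc_rel D : rel V := [rel x y | (x, y) \in D].

(** Reachability along the arcs of [D] is symmetric, that is, each weak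
    component of [D] is strongly connected. *)
Definition balanced D : bool :=
  [forall x, forall y, connect (arc_rel D) x y ==> connect (arc_rel D) y x].

(** No arc of [D] leaves [U]. *)
Definition out_closed D U : Prop :=
  forall x y, (x, y) \in D -> x \in U -> y \in U.

(** No arc of [D] enters [U]. *)
Definition in_closed D U : Prop :=
  forall x y, (x, y) \in D -> y \in U -> x \in U.

Lemma unbalanced_cut D :
  ~~ balanced D -> exists2 U, out_closed D U & ~ in_closed D U.
Proof.
case/forallPn=> x /forallPn[y]; rewrite negb_imply => /andP[xy yx].
exists [set z | connect (arc_rel D) y z].
  by move=> a b Dab; rewrite !inE => /connect_trans; apply; apply: connect1.
move=> inU; case/negP: yx; apply: contraT => yx.
have := @connect_stable (arc_rel D) [pred z | ~~ connect (arc_rel D) y z] x y.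
rewrite /= connect0; apply=> // a b Dab.
by apply: contra => yb; have := inU a b Dab; rewrite !inE => ->.
Qed.

Lemma balancedP D :
  reflect (forall U, out_closed D U -> in_closed D U) (balanced D).
Proof.
apply: (iffP idP) => [/forallP balD U outU x y Dxy Uy | cutD].
  have /forallP/(_ y)/implyP/(_ (connect1 Dxy)) yx := balD x.
  by apply: (connect_stable (P := mem U)) yx Uy.
by apply: contraT => /unbalanced_cut[U /cutD].
Qed.

Lemma out_closedU1 D U u v :
  out_closed D U -> (u \in U -> v \in U) -> out_closed ((u, v) |: D) U.
Proof. by move=> outU uv x y /setU1P[[-> ->]|] //; apply: outU. Qed.

Lemma out_closedW D D' U : D \subset D' -> out_closed D' U -> out_closed D U.
Proof. by move=> /subsetP DD' outU x y /DD'; apply: outU. Qed.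

Lemma in_closedW D D' U : D \subset D' -> in_closed D' U -> in_closed D U.
Proof. by move=> /subsetP DD' inU x y /DD'; apply: inU. Qed.

(** [u] and [v] lie in the same weak component of [D]. *)
Definition linked D u v : Prop :=
  forall U, out_closed D U -> in_closed D U -> (u \in U) = (v \in U).

Lemma balancedU1 D u v : linked D u v -> balanced D -> balanced ((u, v) |: D).
Proof.
move=> uv /balancedP balD; apply/balancedP=> U outU.
have outD := out_closedW (subsetUr _ _) outU.
move=> x y /setU1P[[-> ->] | ]; last exact: balD.
by rewrite (uv U) //; apply: balD.
Qed.

Lemma balanced_del D u v :
  balanced ((u, v) |: D) -> balanced ((v, u) |: D) -> balanced D.
Proof.
move=> /balancedP bal_uv /balancedP bal_vu; apply/balancedP=> U outU.
have [uU | uU] := boolP (u \in U).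
  apply: in_closedW (subsetUr _ _) (bal_vu U _).
  exact: out_closedU1.
apply: in_closedW (subsetUr _ _) (bal_uv U _).
by apply: out_closedU1 => //; rewrite (negPf uU).
Qed.

(** If neither orientation of the edge were enough, there would be an
    out-closed set [U] containing [v] but not [u], and an out-closed set [W]
    containing [u] but not [v].  No arc of [D] enters or leaves their union
    and their intersection, hence none enters or leaves the difference of [U]
    and [W], which separates [u] from [v]. *)
Lemma balanced_choose D u v :
    linked D u v -> balanced ((u, v) |: ((v, u) |: D)) ->
  balanced ((u, v) |: D) || balanced ((v, u) |: D).
Proof.
move=> uv /balancedP bal2.
(* An out-closed set of [D] is out-closed for both arcs of the edge as well,
   unless it separates [u] from [v]. *)
have inD Z : out_closed D Z -> (u \in Z) = (v \in Z) -> in_closed D Z.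
  move=> outZ uvZ; have DD : D \subset (u, v) |: ((v, u) |: D).
    by rewrite setUA subsetUr.
  apply: in_closedW DD (bal2 Z _).
  by apply: out_closedU1; rewrite ?uvZ //; apply: out_closedU1; rewrite ?uvZ.
(* Stated for any [a] and [b], to be used at [u, v] and at [v, u]. *)
have cut a b :
    (forall Z, out_closed D Z -> (a \in Z) = (b \in Z) -> in_closed D Z) ->
    ~~ balanced ((a, b) |: D) ->
    exists2 Z, out_closed D Z & (b \in Z) && (a \notin Z).
  move=> inZ /unbalanced_cut[Z outZ ninZ].
  have outDZ := out_closedW (subsetUr _ _) outZ.
  have ab : a \in Z -> b \in Z by apply: outZ; rewrite setU11.
  exists Z => //; have [abZ | ] := eqVneq (a \in Z) (b \in Z).
    by case: ninZ => x y /setU1P[[-> ->] | ]; [rewrite abZ | apply: inZ].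
  by case: (a \in Z) ab => [/(_ isT)-> | _]; case: (b \in Z).
apply: contraT; rewrite negb_or => /andP[/(cut _ _ inD)[U outU /andP[vU uU]]].
case/(cut v u)=> [Z outZ vuZ | W outW /andP[uW vW]]; first exact: inD.
have outI : out_closed D (U :&: W).
  by move=> x y Dxy /setIP[xU xW]; rewrite inE (outU _ _ Dxy xU) (outW _ _ Dxy xW).
have outUW : out_closed D (U :|: W).
  move=> x y Dxy.
  by case/setUP=> [/(outU _ _ Dxy) | /(outW _ _ Dxy)] yUW; rewrite inE yUW ?orbT.
(* Neither set separates [u] from [v]: the union contains both and the
   intersection contains none. *)
have inI : in_closed D (U :&: W).
  by apply: inD; rewrite // !inE (negPf uU) (negPf vW) andbF.
have inUW : in_closed D (U :|: W) by apply: inD; rewrite // !inE uW vU orbT.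
have outUDW : out_closed D (U :\: W).
  move=> x y Dxy /setDP[xU xW]; rewrite inE (outU _ _ Dxy xU) andbT.
  apply: contra xW => yW.
  have yUW : y \in U :&: W by rewrite inE yW (outU _ _ Dxy xU).
  by case/(inI _ _ Dxy)/setIP: yUW.
have inUDW : in_closed D (U :\: W).
  move=> x y Dxy /setDP[yU yW].
  have /(inUW _ _ Dxy) : y \in U :|: W by rewrite inE yU.
  have xW : x \notin W by apply: contra yW; apply: outW.
  by rewrite !inE (negPf xW) orbF.
by have := uv _ outUDW inUDW; rewrite !inE vU vW (negPf uU) andbF.
Qed.

Lemma linkedW D D' u v : D \subset D' -> linked D u v -> linked D' u v.
Proof.
move=> DD' uv U outU inU.
by apply: uv; [apply: out_closedW outU | apply: in_closedW inU].
Qed.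

(** The deletion-contraction recurrence, for a single orientation of the other
    edges. *)
Lemma balanced_exchange D u v : linked D u v ->
  (balanced ((u, v) |: D) + balanced ((v, u) |: D) =
   balanced D + balanced ((u, v) |: ((v, u) |: D)))%N.
Proof.
move=> uv; have vu : linked D v u by move=> U outU inU; rewrite (uv U).
have b_uv := balancedU1 uv; have b_vu := balancedU1 vu.
have b_2 : balanced ((v, u) |: D) -> balanced ((u, v) |: ((v, u) |: D)).
  exact: balancedU1 (linkedW (subsetUr _ _) uv).
have b_2' : balanced ((u, v) |: D) -> balanced ((u, v) |: ((v, u) |: D)).
  by rewrite setUCA; apply: balancedU1 (linkedW (subsetUr _ _) vu).
have := balanced_del (D := D) (u := u) (v := v).
have := balanced_choose uv.
case: (balanced D) b_uv b_vu => [/(_ isT)-> /(_ isT) b|_ _].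
  by move: b_2; rewrite b => /(_ isT)->.
case: (balanced ((u, v) |: D)) b_2' => [/(_ isT)->|_].
  by case: (balanced ((v, u) |: D)) => // _ /(_ isT isT).
case: (balanced ((v, u) |: D)) b_2 => [/(_ isT)->|_] //=.
by case: (balanced _) => // /(_ isT).
Qed.

End Balanced.

(** * Components of a set of edges *)

Section Components.

Variable V : finType.
Implicit Types (F E S : {set {set V}}) (u v x y : V).

(** Adjacency along an edge of [F]. *)
Definition edge_rel F : rel V := [rel x y | [set x; y] \in F].

(** The number of components of the graph on all of [V] with edge set [F]. *)
Definition ncomp F : nat :=
  #|[set [set y | connect (edge_rel F) x y] | x in [set: V]]|.

Lemma eq_set2 x y u v :
  ([set x; y] == [set u; v]) = ((x, y) == (u, v)) || ((x, y) == (v, u)).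
Proof.
apply/eqP/orP=> [xy_uv | [] /eqP[-> ->] //]; last by rewrite setUC.
have : x \in [set u; v] by rewrite -xy_uv set21.
have : y \in [set u; v] by rewrite -xy_uv set22.
have : u \in [set x; y] by rewrite xy_uv set21.
have : v \in [set x; y] by rewrite xy_uv set22.
rewrite !xpair_eqE !inE !(eq_sym u) !(eq_sym v).
by case: (x == u) (x == v) (y == u) (y == v) => [] [] [] []; auto.
Qed.

Lemma edge_connect_sym F : connect_sym (edge_rel F).
Proof. by apply: sym_connect_sym => x y; rewrite /edge_rel /= setUC. Qed.

Lemma edge_connectS F F' x y :
  F \subset F' -> connect (edge_rel F) x y -> connect (edge_rel F') x y.
Proof.
by move=> /subsetP sFF'; apply: connect_sub => a b /= ab; apply/connect1; apply: sFF'.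
Qed.

(** Two vertices are joined after the addition of an edge if and only if they
    were joined before or both were joined to an end of that edge. *)
Lemma edge_connectU1 F u v x y :
  connect (edge_rel ([set u; v] |: F)) x y =
  connect (edge_rel F) x y ||
  (connect (edge_rel F) u x || connect (edge_rel F) v x) &&
  (connect (edge_rel F) u y || connect (edge_rel F) v y).
Proof.
set c := connect (edge_rel F).
have cC : forall a b, c a b = c b a by move=> a b; apply: edge_connect_sym.
have cT : forall b a d, c a b -> c b d -> c a d by move=> b a d; apply: connect_trans.
have c0 : forall a, c a a by move=> a; apply: connect0.
set c' := connect _.
have c'C : forall a b, c' a b = c' b a by move=> a b; apply: edge_connect_sym.
have cc' : forall a b, c a b -> c' a b.
  by move=> a b; apply/edge_connectS/subsetUr.
have c'uv : c' u v by apply: connect1; rewrite /edge_rel /= setU11.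
apply/idP/idP.
  pose P z := c x z || (c u x || c v x) && (c u z || c v z).
  move=> xy; apply: (connect_stable (P := P)) xy _; last by rewrite /P c0.
  move=> a b; rewrite /P /edge_rel /= !inE eq_set2 => /orP[|ab].
    case/orP=> /eqP[-> ->]; rewrite (cC x) => Pa;
      have -> : c u x || c v x by case/orP: Pa => [->|/andP[]//]; rewrite ?orbT.
    - by rewrite (c0 v) !orbT.
    - by rewrite (c0 u) !orbT.
  have {}ab : c a b := connect1 ab.
  case/orP=> [/cT/(_ ab)-> // | /andP[->]].
  by case/orP=> /cT/(_ ab)->; rewrite ?orbT.
case/orP=> [/cc' // | /andP[xx yy]].
have c'u z : c u z || c v z -> c' u z.
  by case/orP=> /cc' // vz; apply: connect_trans c'uv vz.
by apply: connect_trans (c'u _ yy); rewrite -/c' c'C c'u.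
Qed.

Lemma ncomp_joined F u v :
  connect (edge_rel F) u v -> ncomp ([set u; v] |: F) = ncomp F.
Proof.
move=> uv; rewrite /ncomp; congr #|pred_of_set _|; apply: eq_imset => x.
apply/setP=> y; rewrite !inE edge_connectU1.
have vE z : connect (edge_rel F) v z = connect (edge_rel F) u z.
  by rewrite (same_connect (@edge_connect_sym F) uv).
rewrite !vE !orbb; case: (boolP (connect _ x y)) => //= xy.
apply: contraNF xy => /andP[ux uy].
by rewrite -(same_connect (@edge_connect_sym F) ux).
Qed.

(** The components of [u] and [v] are replaced by their union. *)
Lemma ncomp_join F u v :
  ~~ connect (edge_rel F) u v -> (ncomp ([set u; v] |: F)).+1 = ncomp F.
Proof.
move=> uv; rewrite /ncomp.
pose C x := [set y | connect (edge_rel F) x y].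
have CE x y : (C x == C y) = connect (edge_rel F) x y.
  apply/eqP/idP=> [/setP/(_ y) | xy]; first by rewrite !inE connect0.
  by apply/setP=> z; rewrite !inE (same_connect (@edge_connect_sym F) xy).
set comps := [set C x | x in _].
have inC x : C x \in comps by apply: imset_f.
have -> : [set [set y | connect (edge_rel ([set u; v] |: F)) x y] | x in [set: V]]
    = (C u :|: C v) |: (comps :\ C u :\ C v).
  have C'E x : [set y | connect (edge_rel ([set u; v] |: F)) x y] =
      if x \in C u :|: C v then C u :|: C v else C x.
    apply/setP=> y; rewrite inE edge_connectU1 !inE.
    case: ifP => [|_]; last by rewrite orbF inE.
    case/orP=> /(same_connect (@edge_connect_sym F)) Ex; rewrite !inE -Ex ?connect0 /=.
      by rewrite orbA orbb.
    by rewrite orbC -orbA orbb.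
  apply/setP=> Z; apply/imsetP/idP=> [[x _ ->] | ].
    rewrite C'E; case: ifP => [_ | ]; first exact: setU11.
    by rewrite !inE -!CE !(eq_sym _ (C x)) inC => /norP[-> ->]; rewrite orbT.
  case/setU1P=> [-> | /setD1P[Zv /setD1P[Zu /imsetP[x _ Zx]]]].
    by exists u; rewrite // C'E !inE connect0.
  exists x => //; rewrite C'E !inE -!CE -Zx !(eq_sym _ Z).
  by rewrite (negPf Zu) (negPf Zv).
have nin : C u :|: C v \notin comps :\ C u :\ C v.
  apply/negP=> /setD1P[_ /setD1P[Zu /imsetP[x _ Zx]]].
  have : u \in C x by rewrite -Zx !inE connect0.
  by rewrite inE -CE -Zx (negPf Zu).
rewrite cardsU1 nin (cardsD1 (C u) comps) inC (cardsD1 (C v) (comps :\ C u)).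
by rewrite !inE inC eq_sym CE uv.
Qed.

Lemma ncompS F F' : F \subset F' -> (ncomp F' <= ncomp F)%N.
Proof.
move=> sFF'; rewrite /ncomp; set comps' := imset _ _; set comps := imset _ _.
(* [merge] sends the component of a vertex for [F] to its component for [F']. *)
pose merge (C : {set V}) := [set y | [exists x in C, connect (edge_rel F') x y]].
suffices /subset_leq_card le : comps' \subset merge @: comps.
  exact: leq_trans le (leq_imset_card _ _).
apply/subsetP=> _ /imsetP[x _ ->]; apply/imsetP.
exists [set y | connect (edge_rel F) x y]; first exact: imset_f.
apply/setP=> y; rewrite !inE; apply/idP/existsP=> [xy | [z /andP[]]].
  by exists x; rewrite inE connect0.
by rewrite inE => /(edge_connectS sFF'); apply: connect_trans.
Qed.

End Components.

(** * Orientations *)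

Section Orientations.

Variable V : finType.
Implicit Types (F E S : {set {set V}}) (A : {set V * V}) (u v x y : V).

(** [A] contains exactly one arc on each edge in [E], and no other arc. *)
Definition orients E A : bool :=
  [forall u, forall v,
     if [set u; v] \in E then ((u, v) \in A) (+) ((v, u) \in A)
     else (u, v) \notin A].

(** Both arcs of each edge in [S]. *)
Definition both_arcs S : {set V * V} := [set p | [set p.1; p.2] \in S].

Lemma orientsP E A :
  reflect (forall u v, if [set u; v] \in E then ((u, v) \in A) (+) ((v, u) \in A)
                       else (u, v) \notin A) (orients E A).
Proof.
apply: (iffP forallP) => [oA u v | oA u]; first exact: (forallP (oA u)).
exact/forallP/oA.
Qed.

Lemma orients0 A : orients set0 A = (A == set0).
Proof.
apply/orientsP/eqP=> [oA | -> u v]; last by rewrite !inE.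
by apply/setP=> -[u v]; have := oA u v; rewrite !inE => /negPf.
Qed.

(** The orientations of [E] with one more edge that use the arc [(u, v)] are
    the orientations of [E] with that arc added. *)
Lemma orientsU1 E A u v : u != v -> [set u; v] \notin E ->
  orients ([set u; v] |: E) A && ((u, v) \in A) =
  ((u, v) \in A) && orients E (A :\ (u, v)).
Proof.
move=> uv uvE; rewrite andbC; case: (boolP ((u, v) \in A)) => //= Auv.
have vuF : (v, u) == (u, v) = false by rewrite xpair_eqE eq_sym (negPf uv).
apply/orientsP/orientsP=> oA x y; have := oA x y; rewrite !inE eq_set2.
  have [[-> ->] | xy] /= := eqVneq (x, y) (u, v); first by rewrite (negPf uvE).
  have [[-> ->] | yx] /= := eqVneq (x, y) (v, u).
    by rewrite setUC (negPf uvE) Auv; case: (_ \in A).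
  by have -> // : (y, x) != (u, v) by apply: contra yx => /eqP[-> ->].
have [[-> ->] | xy] /= := eqVneq (x, y) (u, v).
  rewrite (negPf uvE) Auv => _; have := oA v u.
  by rewrite setUC (negPf uvE) !inE vuF /= => /negPf->.
have [[-> ->] | yx] /= := eqVneq (x, y) (v, u).
  by rewrite setUC (negPf uvE) => /negPf->; rewrite Auv.
by have -> // : (y, x) != (u, v) by apply: contra yx => /eqP[-> ->].
Qed.

Section Sums.

Variables (R : nzRingType).

Lemma sum_subsetsU1 (T : finType) (a : T) (B : {set T}) (g : {set T} -> R) :
    a \notin B ->
  \sum_(F : {set T} | F \subset a |: B) g F =
  \sum_(F : {set T} | F \subset B) (g F + g (a |: F)).
Proof.
move=> aB; rewrite (bigID [pred F : {set T} | a \in F]) /= addrC big_split /=.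
congr (_ + _).
  by apply: eq_bigl => F /=; rewrite -[in RHS](setU1K aB) subsetD1.
rewrite (reindex_onto (fun Z => a |: Z) (fun Z => Z :\ a)) /=; last first.
  by move=> F /andP[_ aF]; rewrite setD1K.
apply: eq_bigl => F; rewrite setU11 andbT subUset sub1set setU11 /=.
apply/andP/idP=> [[sF /eqP <-] | sF].
  by rewrite -[B](setU1K aB) setSD // subUset sub1set setU11.
by rewrite (subset_trans sF) ?subsetUr // setU1K // (contra (subsetP sF a)).
Qed.

Lemma sum_orientsU1 E u v (g : {set V * V} -> R) :
    u != v -> [set u; v] \notin E ->
  \sum_(A | orients ([set u; v] |: E) A) g A =
  \sum_(A | orients E A) (g ((u, v) |: A) + g ((v, u) |: A)).
Proof.
have half x y : x != y -> [set x; y] \notin E ->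
    \sum_(A | orients ([set x; y] |: E) A && ((x, y) \in A)) g A =
    \sum_(A | orients E A) g ((x, y) |: A).
  move=> xy xyE; rewrite (eq_bigl _ _ (fun A => orientsU1 A xy xyE)).
  rewrite (reindex_onto (fun A => (x, y) |: A) (fun A => A :\ (x, y))) /=; last first.
    by move=> A /andP[xyA _]; rewrite setD1K.
  apply: eq_bigl => A; rewrite setU11 /=; apply/andP/idP=> [[oA /eqP<- //] | oA].
  have xyA : (x, y) \notin A by have /orientsP/(_ x y) := oA; rewrite (negPf xyE).
  by rewrite setU1K.
move=> uv uvE; rewrite (bigID [pred A : {set V * V} | (u, v) \in A]) /= big_split /=.
congr (_ + _); first exact: half.
rewrite -half 1?eq_sym //; last by rewrite setUC.
rewrite [[set v; u]]setUC; apply: eq_bigl => A.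
case: (boolP (orients _ A)) => //= /orientsP/(_ u v).
by rewrite setU11; case: (_ \in A); case: (_ \in A).
Qed.

End Sums.

Lemma edge_arc S E A x y : orients E A -> edge_rel (S :|: E) x y ->
  (x, y) \in both_arcs S :|: A \/ (y, x) \in both_arcs S :|: A.
Proof.
move=> /orientsP/(_ x y) oA; rewrite /edge_rel /= !inE /=.
case/orP=> [-> | xyE]; first by left.
move: oA; rewrite xyE; case: ((x, y) \in A) => [_ | /= ->]; [left | right];
  by rewrite orbT.
Qed.

Lemma arc_edge S E A x y : orients E A -> (x, y) \in both_arcs S :|: A ->
  edge_rel (S :|: E) x y.
Proof.
move=> /orientsP/(_ x y) oA; rewrite /edge_rel /= !inE /=.
by case/orP=> [-> // | xyA]; move: oA; rewrite xyA; case: ifP; rewrite ?orbT.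
Qed.

(** Each edge of [E] carries an arc of [A] and each edge of [S] carries both of
    its arcs, so a set that no arc enters or leaves is a union of components of
    the graph with edge set [S :|: E]. *)
Lemma connect_linked S E A u v : orients E A ->
  connect (edge_rel (S :|: E)) u v -> linked (both_arcs S :|: A) u v.
Proof.
move=> oA uv U outU inU.
have stab a b : edge_rel (S :|: E) a b -> a \in U -> b \in U.
  by case/(edge_arc oA) => ab; [apply: outU ab | apply: inU ab].
apply/idP/idP; first exact: (connect_stable (P := mem U) stab uv).
by rewrite edge_connect_sym in uv; apply: (connect_stable (P := mem U) stab uv).
Qed.

(** The component of [v] in the graph with edge set [S :|: E] is entered by
    [(u, v)], and no arc leaves it. *)
Lemma bridge_unbalanced S E A u v : orients E A ->
    ~~ connect (edge_rel (S :|: E)) u v ->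
  balanced ((u, v) |: (both_arcs S :|: A)) = false.
Proof.
move=> oA uv; apply: contraNF uv => /balancedP bal.
pose U := [set z | connect (edge_rel (S :|: E)) v z].
rewrite edge_connect_sym -[connect _ _ _]/(u \in _).
have [uU | uU] := boolP (u \in U); first by rewrite inE in uU.
suffices /bal/(_ u v) : out_closed ((u, v) |: (both_arcs S :|: A)) U.
  by rewrite setU11 !inE connect0; apply.
apply: out_closedU1; last by rewrite (negPf uU).
move=> x y /(arc_edge oA) xy; rewrite !inE => /connect_trans; apply.
exact: connect1.
Qed.

Lemma balanced_both_arcs S : balanced (both_arcs S).
Proof.
apply/forallP=> x; apply/forallP=> y; apply/implyP.
by rewrite (sym_connect_sym (e := arc_rel _)) // => a b; rewrite /arc_rel /= !inE setUC.
Qed.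

Lemma both_arcsU1 S u v :
  both_arcs ([set u; v] |: S) = (u, v) |: ((v, u) |: both_arcs S).
Proof. by apply/setP=> -[x y]; rewrite !inE eq_set2 orbA. Qed.

(** The alternating sum formula, with the edges of [S] contracted.  The sets [S]
    and [E] need not be disjoint: an edge of both acts as a loop. *)
Theorem balanced_orientations (R : nzRingType) S E :
    (forall e, e \in E -> #|e| = 2%N) ->
  \sum_(A | orients E A) (balanced (both_arcs S :|: A))%:R =
  \sum_(F : {set {set V}} | F \subset E)
     (-1) ^+ (ncomp (S :|: F) + ncomp (S :|: E)) :> R.
Proof.
have [n] := ubnP #|E|; elim: n => // n IHn in S E *; rewrite ltnS => leEn E2.
have [-> | [e eE]] := set_0Vmem E.
  rewrite (big_pred1 set0) => [|A]; last by rewrite orients0.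
  rewrite (big_pred1 set0) => [|F]; last by rewrite subset0.
  by rewrite !setU0 balanced_both_arcs addnn -signr_odd odd_double.
have /eqP/cards2P[u [v [uv eE2]]] := E2 e eE.
rewrite {e}eE2 in eE.
move: leEn; rewrite -(setD1K eE).
have: [set u; v] \notin E :\ [set u; v] by rewrite !inE eqxx.
have E'2 f : f \in E :\ [set u; v] -> #|f| = 2%N by case/setD1P=> _ /E2.
move: (E :\ _) E'2 => E' E'2 uvE'; rewrite cardsU1 uvE' => leEn.
rewrite sum_orientsU1 // sum_subsetsU1 //.
have UC F : S :|: ([set u; v] |: F) = [set u; v] |: (S :|: F) by rewrite setUCA.
have [conn | disc] := boolP (connect (edge_rel (S :|: E')) u v); last first.
  rewrite !big1 // => [F sF | A oA].
    have discF : ~~ connect (edge_rel (S :|: F)) u v.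
      by apply: contra disc; apply/edge_connectS/setUS.
    by rewrite !UC -(ncomp_join discF) addSn exprS mulN1r addNr.
  have vu : ~~ connect (edge_rel (S :|: E')) v u by rewrite edge_connect_sym.
  by rewrite !(setUCA (both_arcs S)) !(bridge_unbalanced oA) // addr0.
(* Deletion keeps [S]; contraction moves the edge to [S]. *)
rewrite (eq_bigr (fun A => (balanced (both_arcs S :|: A))%:R +
    (balanced (both_arcs ([set u; v] |: S) :|: A))%:R)) => [|A oA]; last first.
  rewrite !(setUCA (both_arcs S)) -!natrD balanced_exchange.
    by rewrite both_arcsU1 !setUA.
  exact: connect_linked oA conn.
rewrite !big_split /= !IHn //; congr (_ + _); apply: eq_bigr => F _.
  by rewrite !UC ncomp_joined.
by rewrite !UC -!setUA.
Qed.

End Orientations.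


(** * Evaluation of the Tutte polynomial *)

(** Reachability from a vertex of an out-closed set stays in that set. *)
Lemma connect_induced (V : finType) (A : {set V * V}) (C : {set V}) x y :
    out_closed A C -> x \in C -> connect (arc_rel A) x y ->
  connect (induced_arc A C) x y.
Proof.
move=> outC xC xy; suffices /andP[] : (y \in C) && connect (induced_arc A C) x y by [].
apply: (connect_stable (P := fun z => (z \in C) && connect (induced_arc A C) x z)) xy _.
  move=> a b ab /andP[aC xa]; have bC := outC a b ab aC.
  by rewrite bC; apply: connect_trans xa (connect1 _); rewrite /induced_arc /= aC bC.
by rewrite xC connect0.
Qed.

(** If [A] is balanced, both ends of every edge reach each other along arcs, so
    arcs join any two vertices of a component, without leaving it. *)
Lemma strongly_connected_balanced (G : sgraph) (A : {set vertex G * vertex G}) :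
    orients (edges G) A ->
  [forall C in components G, strongly_connected_on A C] = balanced A.
Proof.
move=> oA; have arcE : both_arcs set0 :|: A = A.
  by apply/setP=> p; rewrite !inE.
have edge x y : adj x y -> (x, y) \in A \/ (y, x) \in A.
  by move=> xy; rewrite -arcE; apply: edge_arc oA _; rewrite /edge_rel /= set0U.
have arc x y : (x, y) \in A -> adj x y.
  by rewrite -{1}arcE => /(arc_edge oA); rewrite /edge_rel /= set0U.
apply/idP/idP=> [sc | bal].
  apply/forallP=> x; apply/forallP=> y; apply/implyP=> xy.
  have /forall_inP/(_ [set z | connect (@adj G) x z])/(_ (imset_f _ (in_setT x))) := sc.
  have xy' : connect (@adj G) x y.
    by apply: connect_sub xy => a b /arc; apply: connect1.
  move=> /forall_inP/(_ y); rewrite inE => /(_ xy')/forall_inP/(_ x).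
  rewrite inE connect0 => /(_ isT); apply: connect_sub => a b /and3P[_ _ ab].
  exact: connect1.
have balE x y : connect (@adj G) x y -> connect (arc_rel A) x y.
  apply: connect_sub => a b /edge[] ab; first exact: connect1.
  by have /forallP/(_ b)/forallP/(_ a)/implyP := bal; apply; apply: connect1.
apply/forall_inP=> _ /imsetP[z _ ->].
apply/forall_inP=> x zx; apply/forall_inP=> y; rewrite inE => zy.
apply: connect_induced => //.
  by move=> a b /arc ab; rewrite !inE => /connect_trans; apply; apply: connect1.
apply: balE; rewrite inE in zx; apply: connect_trans zy.
by rewrite (edge_connect_sym (edges G)).
Qed.

(** At 2 the second factor becomes a power of 1.  The truncated exponent of -1
    is a true difference by [ncompS], hence has the parity of the sum. *)
Lemma tutte_eval (K : fieldType) (G : sgraph) :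
  (tutte K G).@[tnth [tuple 0; 2%:R]] =
  \sum_(F : {set {set vertex G}} | F \subset edges G)
     (-1) ^+ (ncomp F + ncomp (edges G)).
Proof.
rewrite /tutte raddf_sum /=; apply: eq_bigr => F /setIidPr sF.
have ccF : cc (restrict F) = ncomp F by rewrite -[in RHS]sF.
rewrite rmorphM !rmorphXn !rmorphB !rmorph1 /= !mevalXU ccF.
rewrite !(tnth_nth 0) /= sub0r -[2%:R]/(1 + 1) addrK expr1n mulr1.
have le : (ncomp (edges G) <= ncomp F)%N by apply: ncompS; rewrite -sF subsetIl.
rewrite -[in RHS](subnK le) -addnA addnn exprD -[X in _ * X]signr_odd.
by rewrite odd_double mulr1.
Qed.

Theorem proposition4p6 (K : fieldType) (charK0 : [pchar K] =i pred0)
    (G : sgraph) :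
  (tutte K G).@[tnth [tuple 0; 2%:R]] =
  #|[set A : {set vertex G * vertex G} |
      is_orientation A &&
      [forall C in components G, strongly_connected_on A C]]|%:R.
Proof.
rewrite tutte_eval; have := balanced_orientations K set0 (@edges_card2 G).
have s0 : both_arcs (set0 : {set {set vertex G}}) = set0.
  by apply/setP=> p; rewrite !inE.
under [in X in _ = X -> _]eq_bigr => F _ do rewrite !set0U.
move=> <-; rewrite s0 -sum1_card natr_sum.
rewrite [RHS](eq_bigl (fun A => orients (edges G) A && balanced A)) => [|A]; last first.
  rewrite inE -[is_orientation A]/(orients (edges G) A).
  by case: (boolP (orients _ A)) => //= /strongly_connected_balanced->.
rewrite big_mkcondr /=; apply: eq_bigr => A _.
by rewrite set0U; case: (balanced A).
Qed.
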